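(* Let $n\ge 1$, let $W_{B_n}$ be the Weyl group of type $B_n$ with simple reflections $s_1,\dots,s_n$, and let $\mathsf{P}_n^{ext}=\mathbb{Q}[x_1,\dots,x_n]\otimes\bigwedge[\omega_1,\dots,\omega_n]$. Let $s_1,\dots,s_n$ act on $\mathsf{P}_n^{ext}$ as $\mathbb{Q}$-algebra automorphisms determined on generators as follows. For $1\le i\le n-1$ and $1\le j\le n$, $$s_i(x_j)=x_{s_i(j)},\qquad s_i(\omega_j)=\omega_j+\delta_{ij}(x_i^2-x_{i+1}^2)\,\omega_{i+1},$$ and $$s_n(x_j)=x_j\ (1\le j\le n-1),\qquad s_n(x_n)=-x_n,\qquad s_n(\omega_j)=\omega_j\ (1\le j\le n).$$ Then this defines an action of $W_{B_n}$ on $\mathsf{P}_n^{ext}$.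
   Context: $W_{B_n}$ is the group generated by $s_1,\dots,s_n$ such that $s_1,\dots,s_{n-1}$ satisfy the Coxeter relations of the simple transpositions of the symmetric group $S_n$ (and generate a copy of $S_n$), together with the relations $s_n^2=1$, $s_ns_i=s_is_n$ for $1\le i\le n-2$, and $s_ns_{n-1}s_ns_{n-1}=s_{n-1}s_ns_{n-1}s_n$. For $i<n$, $s_i(j)$ denotes the image of $j$ under the transposition $(i,\,i+1)$. $\bigwedge[\omega_1,\dots,\omega_n]$ is the exterior algebra over $\mathbb{Q}$ on $\omega_1,\dots,\omega_n$; the $x_i$ commute with the $\omega_j$. *)

(* Defs.v *)
From HB Require Import structures.
From mathcomp Require Import all_boot all_order all_algebra.
From mathcomp Require Import perm generic_quotient.
From mathcomp Require Import boolp.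
From mathcomp Require Import mpoly.
From mathcomp Require Import ring.

Set Implicit Arguments.
Unset Strict Implicit.
Unset Printing Implicit Defensive.

Import GRing.Theory.
Local Open Scope ring_scope.

Section ExteriorSign.
Variable n : nat.
Implicit Types A B C : {set 'I_n}.

Definition ninv A B : nat := \sum_(a in A) \sum_(b in B) (b < a)%N.

Lemma ninvUl A B C : [disjoint A & B] -> ninv (A :|: B) C = (ninv A C + ninv B C)%N.
Proof.
by move=> dAB; rewrite /ninv -bigU //=; apply: eq_bigl => i; rewrite !inE.
Qed.

Lemma ninvUr A B C : [disjoint B & C] -> ninv A (B :|: C) = (ninv A B + ninv A C)%N.
Proof.
move=> dBC; rewrite /ninv -big_split; apply: eq_bigr => a _.
by rewrite -bigU //=; apply: eq_bigl => i; rewrite !inE.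
Qed.

Lemma ninv0l A : ninv set0 A = 0%N.
Proof. by rewrite /ninv big_set0. Qed.

Lemma ninv0r A : ninv A set0 = 0%N.
Proof. by rewrite /ninv big1 // => a _; rewrite big_set0. Qed.
End ExteriorSign.

(* [extalg A n] is A (x)_k /\_k[w_1, .., w_n].  It is free over A on the
   monomials w_S = w_{i_1} /\ .. /\ w_{i_p}, S = {i_1 < .. < i_p}, and f encodes
   the sum of the f(S) (x) w_S.  For disjoint S and T, w_S /\ w_T is
   (-1)^(ninv S T) w_(S u T), and it vanishes otherwise. *)
Definition extalg (k : comNzRingType) (A : comAlgType k) (n : nat) : Type :=
  {ffun {set 'I_n} -> A}.

Section ExteriorAlgebra.
Variables (k : comNzRingType) (A : comAlgType k) (n : nat).
Local Notation E := (extalg A n).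
Implicit Types (f g h : E) (S T U : {set 'I_n}).

HB.instance Definition _ := Equality.copy E {ffun {set 'I_n} -> A}.
HB.instance Definition _ := Choice.copy E {ffun {set 'I_n} -> A}.
HB.instance Definition _ := GRing.Lmodule.copy E {ffun {set 'I_n} -> A}.

Definition ext_one : E := [ffun S : {set 'I_n} => (S == set0)%:R].

Definition ext_mul f g : E :=
  [ffun S : {set 'I_n} => \sum_(T : {set 'I_n} | T \subset S)
               (-1) ^+ ninv T (S :\: T) * f T * g (S :\: T)].

Fact ext_mulA : associative ext_mul.
Proof.
move=> f g h; apply/ffunP => S; rewrite !ffunE.
under [RHS]eq_bigr => U _ do rewrite ffunE mulr_sumr mulr_suml.
rewrite [RHS](exchange_big_dep (fun T => T \subset S)) /=; last first.
  by move=> U T sUS sTU; apply: subset_trans sUS.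
apply: eq_bigr => T sTS; rewrite ffunE mulr_sumr.
rewrite [RHS](reindex_onto (fun U => T :|: U) (fun U => U :\: T)) /=; last first.
  by move=> U /andP[_ sTU]; rewrite -{2}(setID U T) (setIidPr sTU).
have TUD U : ((T :|: U) :\: T == U) = [disjoint T & U].
  rewrite setDUl setDv set0U disjoint_sym.
  by apply/eqP/idP => [/setDidPl|/setDidPl].
apply: eq_big => [U | U].
  by rewrite subsetUl andbT subUset sTS /= subsetD TUD [X in _ && X]disjoint_sym.
rewrite subsetD disjoint_sym => /andP[sUS dTU].
have /eqP -> : (T :|: U) :\: T == U by rewrite TUD.
have dUV : [disjoint U & S :\: (T :|: U)].
  by rewrite -setDDl disjoint_sym -setI_eq0 setIC setIDA setIC -setIDA setDv setI0.
have eST : S :\: T = U :|: (S :\: (T :|: U)).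
  rewrite -setDDl -{1}(setID (S :\: T) U); congr (_ :|: _).
  by apply/setIidPr; rewrite subsetD sUS disjoint_sym.
have -> : S :\: T :\: U = S :\: (T :|: U) by rewrite setDDl.
rewrite {1}eST ninvUr // ninvUl // !exprD; set V := S :\: (T :|: U).
set a := (-1) ^+ _; set b := (-1) ^+ _; set c := (-1) ^+ _.
ring.
Qed.

Fact ext_mul1 : left_id ext_one ext_mul.
Proof.
move=> f; apply/ffunP => S; rewrite ffunE (bigD1 set0) ?sub0set //= big1.
  by rewrite ffunE eqxx setD0 ninv0l mul1r mul1r addr0.
by move=> T /andP[_ nT]; rewrite ffunE (negPf nT) mulr0 mul0r.
Qed.

Fact ext_mulr1 : right_id ext_one ext_mul.
Proof.
move=> f; apply/ffunP => S; rewrite ffunE (bigD1 S) ?subxx //= big1.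
  by rewrite ffunE setDv eqxx ninv0r mul1r mulr1 addr0.
move=> T /andP[sTS nT]; rewrite ffunE setD_eq0.
case sST: (S \subset T); last by rewrite mulr0.
by move: nT; rewrite eqEsubset sTS sST.
Qed.

Fact ext_mulDl : left_distributive ext_mul +%R.
Proof.
move=> f g h; apply/ffunP => S; rewrite !ffunE -big_split /=.
by apply: eq_bigr => T _; rewrite !ffunE mulrDr mulrDl.
Qed.

Fact ext_mulDr : right_distributive ext_mul +%R.
Proof.
move=> f g h; apply/ffunP => S; rewrite !ffunE -big_split /=.
by apply: eq_bigr => T _; rewrite !ffunE mulrDr.
Qed.

Fact ext_one_neq0 : ext_one != 0.
Proof.
apply/eqP => /ffunP /(_ set0); rewrite !ffunE eqxx => /eqP.
by rewrite oner_eq0.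
Qed.

HB.instance Definition _ := GRing.Zmodule_isNzRing.Build E
  ext_mulA ext_mul1 ext_mulr1 ext_mulDl ext_mulDr ext_one_neq0.

Fact ext_scaleAl (c : k) f g : c *: (f * g) = (c *: f) * g.
Proof.
apply/ffunP => S; rewrite !ffunE scaler_sumr.
by apply: eq_bigr => T _; rewrite !ffunE -scalerAr -scalerAl.
Qed.

Fact ext_scaleAr (c : k) f g : c *: (f * g) = f * (c *: g).
Proof.
apply/ffunP => S; rewrite !ffunE scaler_sumr.
by apply: eq_bigr => T _; rewrite !ffunE -scalerAr.
Qed.

HB.instance Definition _ := GRing.Lmodule_isLalgebra.Build k E ext_scaleAl.
HB.instance Definition _ := GRing.Lalgebra_isAlgebra.Build k E ext_scaleAr.

Definition ext_coef (a : A) : E := [ffun S : {set 'I_n} => if S == set0 then a else 0].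
Definition ext_gen (i : 'I_n) : E := [ffun S : {set 'I_n} => (S == [set i])%:R].

Lemma ext_coef_mull (a : A) f : ext_coef a * f = [ffun S : {set 'I_n} => a * f S] :> E.
Proof.
apply/ffunP => S; rewrite !ffunE (bigD1 set0) ?sub0set //= big1.
  by rewrite ffunE eqxx setD0 ninv0l mul1r addr0.
by move=> T /andP[_ nT]; rewrite ffunE (negPf nT) mulr0 mul0r.
Qed.

Lemma ext_coef_central (a : A) f : ext_coef a * f = f * ext_coef a.
Proof.
rewrite ext_coef_mull; apply/ffunP => S; rewrite !ffunE (bigD1 S) ?subxx //= big1.
  by rewrite ffunE setDv eqxx ninv0r mul1r addr0 mulrC.
move=> T /andP[sTS nT]; rewrite ffunE setD_eq0.
case sST: (S \subset T); last by rewrite mulr0.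
by move: nT; rewrite eqEsubset sTS sST.
Qed.

Lemma ext_gen_mull i f S :
  (ext_gen i * f) S =
    if i \in S then (-1) ^+ ninv [set i] (S :\ i) * f (S :\ i) else 0.
Proof.
rewrite ffunE; case: ifP => iS.
  rewrite (bigD1 [set i]) ?sub1set //= big1.
    by rewrite ffunE eqxx mulr1 addr0.
  by move=> T /andP[_ nT]; rewrite ffunE (negPf nT) mulr0 mul0r.
rewrite big1 // => T sTS; rewrite ffunE.
by case: eqP sTS => [->|_ _]; rewrite ?sub1set ?iS ?mulr0 ?mul0r.
Qed.

Lemma ext_gen_sq i : ext_gen i * ext_gen i = 0.
Proof.
apply/ffunP => S; rewrite ext_gen_mull !ffunE; case: ifP => // _.
case: eqP => [/setP /(_ i)|_]; last by rewrite mulr0.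
by rewrite !inE eqxx.
Qed.

Lemma ext_gen_anticomm i j : ext_gen i * ext_gen j = - (ext_gen j * ext_gen i).
Proof.
have [->|nij] := eqVneq i j; first by rewrite ext_gen_sq oppr0.
have D1 a b S : a \in S -> (S :\ a == [set b]) = (b != a) && (S == [set a; b]).
  move=> aS; apply/eqP/andP => [SaE | [nba /eqP ->]].
    split; first by have := set11 b; rewrite -SaE !inE => /andP[].
    by rewrite -SaE setD1K.
  by apply/setP => c; rewrite !inE; case: eqP => //= ->; rewrite eq_sym (negPf nba).
apply/ffunP => S; rewrite [RHS]ffunE !ext_gen_mull !ffunE.
case iS: (i \in S); case jS: (j \in S); rewrite ?oppr0 //.
- rewrite !D1 // [j == i]eq_sym nij /= [in RHS]setUC.
  case: eqP => [->|_]; last by rewrite !mulr0 oppr0.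
  rewrite setU1K ?inE // [in RHS]setUC setU1K ?inE 1?eq_sym // /ninv !big_set1 !mulr1.
  by case: (ltngtP i j) nij => [||/val_inj ->]; rewrite ?eqxx //= expr0 expr1 ?opprK.
- rewrite D1 //; case: (S =P _) => [SE|_]; last by rewrite andbF mulr0.
  by move: jS; rewrite SE !inE eqxx orbT.
- rewrite D1 //; case: (S =P _) => [SE|_]; last by rewrite andbF mulr0 oppr0.
  by move: iS; rewrite SE !inE eqxx orbT.
Qed.

End ExteriorAlgebra.

(* Elements of the free group on I are represented by words in letters (i, b),
   where (i, false) is the generator i and (i, true) its formal inverse. *)
Definition word (I : Type) : Type := seq (I * bool).

Definition pword (I : Type) (s : seq I) : word I := [seq (i, false) | i <- s].

Section Presentation.
Variables (I : choiceType) (rel : word I -> word I -> Prop).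

Inductive wcong : word I -> word I -> Prop :=
| WRefl u : wcong u u
| WSym u v : wcong u v -> wcong v u
| WTrans u v w : wcong u v -> wcong v w -> wcong u w
| WCat u u' v v' : wcong u u' -> wcong v v' -> wcong (u ++ v) (u' ++ v')
| WCancel i b : wcong [:: (i, b); (i, ~~ b)] [::]
| WRel u v : rel u v -> wcong u v.

Definition winv (u : word I) : word I := rev [seq (l.1, ~~ l.2) | l <- u].

Definition wcongb (u v : word I) : bool := `[< wcong u v >].

Fact wcongb_refl : reflexive wcongb.
Proof. by move=> u; apply/asboolP; constructor. Qed.

Fact wcongb_sym : ssrbool.symmetric wcongb.
Proof. by move=> u v; apply/asboolP/asboolP; exact: WSym. Qed.

Fact wcongb_trans : transitive wcongb.
Proof.
by move=> v u w /asboolP uv /asboolP vw; apply/asboolP; exact: WTrans vw.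
Qed.

Canonical wcong_equiv := EquivRel wcongb wcongb_refl wcongb_sym wcongb_trans.

(* The group < I | u = v whenever rel u v >. *)
Definition presgroup : Type := {eq_quot wcong_equiv}%qT.

HB.instance Definition _ := Choice.copy presgroup {eq_quot wcong_equiv}%qT.
HB.instance Definition _ := EqQuotient.copy presgroup {eq_quot wcong_equiv}%qT.

Definition pres_class (u : word I) : presgroup := (\pi_presgroup u)%qT.

Lemma pres_classP u v : pres_class u = pres_class v <-> wcong u v.
Proof.
split=> [/eqquotP /asboolP // | uv].
by apply/eqquotP/asboolP.
Qed.

Lemma pres_reprK (g : presgroup) : pres_class (repr g) = g.
Proof. exact: reprK. Qed.

Definition pres_gen (i : I) : presgroup := pres_class (pword [:: i]).
Definition pres_one : presgroup := pres_class [::].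
Definition pres_mul (g h : presgroup) : presgroup :=
  pres_class (repr g ++ repr h).
Definition pres_inv (g : presgroup) : presgroup := pres_class (winv (repr g)).

Lemma wcong_repr u : wcong (repr (pres_class u)) u.
Proof. by apply/pres_classP; rewrite pres_reprK. Qed.

Lemma pres_mulE u v : pres_mul (pres_class u) (pres_class v) = pres_class (u ++ v).
Proof. by apply/pres_classP/WCat; exact: wcong_repr. Qed.

Lemma winvK : involutive winv.
Proof.
move=> u; rewrite /winv map_rev revK -map_comp -[RHS]map_id.
by apply: eq_map => -[i b] /=; rewrite negbK.
Qed.

Lemma wcongV u : wcong (u ++ winv u) [::].
Proof.
elim: u => [|[i b] u IHu]; first exact: WRefl.
have -> : ((i, b) :: u) ++ winv ((i, b) :: u)
    = [:: (i, b)] ++ (u ++ winv u) ++ [:: (i, ~~ b)].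
  by rewrite /winv /= rev_cons -cats1 catA.
apply: (WTrans (v := [:: (i, b)] ++ [::] ++ [:: (i, ~~ b)])).
  exact: WCat (WRefl _) (WCat IHu (WRefl _)).
exact: WCancel.
Qed.

Fact pres_mulA : associative pres_mul.
Proof.
move=> f g h; rewrite -[f]pres_reprK -[g]pres_reprK -[h]pres_reprK.
by rewrite !pres_mulE catA.
Qed.

Fact pres_mul1 : left_id pres_one pres_mul.
Proof. by move=> g; rewrite -[g]pres_reprK pres_mulE. Qed.

Fact pres_mulr1 : right_id pres_one pres_mul.
Proof. by move=> g; rewrite -[g]pres_reprK pres_mulE cats0. Qed.

Fact pres_mulrV : right_inverse pres_one pres_inv pres_mul.
Proof.
by move=> g; rewrite -{1}[g]pres_reprK pres_mulE; apply/pres_classP/wcongV.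
Qed.

Fact pres_mulVr : left_inverse pres_one pres_inv pres_mul.
Proof.
move=> g; rewrite -{2}[g]pres_reprK pres_mulE; apply/pres_classP.
by rewrite -{2}[repr g]winvK; exact: wcongV.
Qed.

HB.instance Definition _ := isGroup.Build presgroup
  pres_mulA pres_mul1 pres_mulr1 pres_mulVr pres_mulrV.

End Presentation.

(* Indices are shifted by one: the ordinal i : 'I_n stands for s_(i+1), so s_n is
   the ordinal l with l.+1 = n, and s_1, .., s_(n-1) are those with i.+1 < n. *)
Inductive weylB_rel (n : nat) : word 'I_n -> word 'I_n -> Prop :=
| WeylB_sq (i : 'I_n) : (i.+1 < n)%N -> weylB_rel (pword [:: i; i]) [::]
| WeylB_comm (i j : 'I_n) : (i.+1 < j)%N -> (j.+1 < n)%N ->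
    weylB_rel (pword [:: i; j]) (pword [:: j; i])
| WeylB_braid (i j : 'I_n) : i.+1 = j -> (j.+1 < n)%N ->
    weylB_rel (pword [:: i; j; i]) (pword [:: j; i; j])
| WeylB_last_sq (l : 'I_n) : l.+1 = n -> weylB_rel (pword [:: l; l]) [::]
| WeylB_last_comm (i l : 'I_n) : l.+1 = n -> (i.+1 < l)%N ->
    weylB_rel (pword [:: l; i]) (pword [:: i; l])
| WeylB_last_braid (i l : 'I_n) : l.+1 = n -> i.+1 = l ->
    weylB_rel (pword [:: l; i; l; i]) (pword [:: i; l; i; l]).

Definition weylB (n : nat) : Type := presgroup (@weylB_rel n).
HB.instance Definition _ (n : nat) := Group.on (weylB n).

Definition weylB_gen (n : nat) (i : 'I_n) : weylB n := pres_gen (@weylB_rel n) i.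

Definition Pext (n : nat) : Type := extalg {mpoly rat[n]} n.
HB.instance Definition _ (n : nat) := GRing.Algebra.on (Pext n).

Definition px (n : nat) (i : 'I_n) : Pext n := ext_coef n ('X_i : {mpoly rat[n]}).
Definition pw (n : nat) (i : 'I_n) : Pext n := ext_gen {mpoly rat[n]} i.

Definition algebra_automorphism (k : comNzRingType) (A : algType k) (f : A -> A) : Prop :=
  [/\ linear f, GRing.monoid_morphism f & bijective f].

Definition simple_reflection_on_generators (n : nat) (i : 'I_n)
    (f : Pext n -> Pext n) : Prop :=
  (forall i' : 'I_n, i.+1 = i' -> forall j : 'I_n,
     f (px j) = px (tperm i i' j) /\
     f (pw j) = pw j + (i == j)%:R * (px i ^+ 2 - px i' ^+ 2) * pw i') /\
  (i.+1 = n -> forall j : 'I_n,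
     f (px j) = (if j == i then - px j else px j) /\
     f (pw j) = pw j).

Definition group_action (G : groupType) (T : Type) (act : G -> T -> T) : Prop :=
  (forall x, act 1%g x = x) /\
  (forall g h x, act (g * h)%g x = act g (act h x)).

(* Main.v *)
(* For i < n, s_i is the coefficientwise substitution x_i <-> x_(i+1) followed by
   the transvection 1 + D, where D = (x_i^2 - x_(i+1)^2) w_(i+1) d/dw_i; s_n is
   the coefficientwise substitution x_n |-> -x_n.  This shows that the s_i exist.
   Algebra endomorphisms agreeing on the x_j and the w_j are equal, which yields
   both uniqueness and the defining relations of W_(B_n), each checked on the
   generators. *)
Require Import Defs.
From HB Require Import structures.
From mathcomp Require Import all_boot all_order all_algebra.
From mathcomp Require Import perm generic_quotient boolp mpoly zify.

Set Implicit Arguments.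
Unset Strict Implicit.
Unset Printing Implicit Defensive.

Import GRing.Theory.
Local Open Scope ring_scope.

(** * Linear maps and algebra homomorphisms of the exterior algebra over [A] *)

Section ExteriorMorphisms.
Variables (k : comNzRingType) (A : comAlgType k) (n : nat).
Local Notation E := (extalg A n).
Local Notation coef := (@ext_coef k A n).
Local Notation gen := (@ext_gen k A n).
Implicit Types (f g : E) (S T : {set 'I_n}).

Lemma ext_coefD a b : coef (a + b) = coef a + coef b.
Proof. by apply/ffunP => S; rewrite !ffunE; case: ifP; rewrite ?addr0. Qed.

Lemma ext_coefZ c a : coef (c *: a) = c *: coef a.
Proof. by apply/ffunP => S; rewrite !ffunE; case: ifP; rewrite ?scaler0. Qed.

Lemma ext_coefM a b : coef (a * b) = coef a * coef b.
Proof.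
by rewrite ext_coef_mull; apply/ffunP => S; rewrite !ffunE; case: ifP; rewrite ?mulr0.
Qed.

Lemma ext_coef1 : coef 1 = 1.
Proof. by apply/ffunP => S; rewrite !ffunE; case: eqP. Qed.

Lemma ext_coef_semilinear : linear coef.
Proof. by move=> c a b; rewrite ext_coefD ext_coefZ. Qed.

HB.instance Definition _ := GRing.isLinear.Build k A E _ coef ext_coef_semilinear.
HB.instance Definition _ :=
  GRing.isMonoidMorphism.Build A E coef (conj ext_coef1 ext_coefM).

Definition ext_monomial S : E := [ffun T : {set 'I_n} => (T == S)%:R].

Lemma ext_monomial0 : ext_monomial set0 = 1.
Proof. by apply/ffunP => S; rewrite !ffunE. Qed.

(** Any element of [S], not only the least, can be pulled to the front: the sign counts the smaller
    elements it passes, and it squares to 1. *)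
Lemma ext_gen_monomial i S : i \in S ->
  ext_monomial S = coef ((-1) ^+ ninv [set i] (S :\ i)) * (gen i * ext_monomial (S :\ i)).
Proof.
move=> iS; apply/ffunP => T; rewrite ext_coef_mull [RHS]ffunE ext_gen_mull !ffunE.
case: ifP => iT; last by rewrite mulr0; case: eqP iT => // ->; rewrite iS.
have -> : (T :\ i == S :\ i) = (T == S).
  by apply/eqP/eqP => [e|-> //]; rewrite -(setD1K iT) e setD1K.
by case: eqP => [->|_]; rewrite ?mulr0 // mulr1 -expr2 sqrr_sign.
Qed.

Lemma ext_monomialE f : f = \sum_S coef (f S) * ext_monomial S.
Proof.
apply/ffunP => T; rewrite sum_ffunE (bigD1 T) //= big1 => [|S nST].
  by rewrite ext_coef_mull !ffunE eqxx mulr1 addr0.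
by rewrite ext_coef_mull !ffunE eq_sym (negPf nST) mulr0.
Qed.

(** Every element is a combination of monomials, and a monomial is built from 1 by left
    multiplications with generators, up to sign. Multiplicativity of maps and equality of morphisms
    are reduced to generators in this way. *)
Lemma ext_ind (P : E -> Prop) :
    P 0 -> P 1 -> (forall f g, P f -> P g -> P (f + g)) ->
    (forall a f, P f -> P (coef a * f)) -> (forall i f, P f -> P (gen i * f)) ->
  forall f, P f.
Proof.
move=> P0 P1 PD Pc Pg f; rewrite [f]ext_monomialE; elim/big_ind: _ => // S _; apply: (Pc).
elim: {S}#|S| {-2}S (erefl #|S|) => [|m IH] S.
  by move/cards0_eq ->; rewrite ext_monomial0.
move=> cS; have /card_gt0P [i iS] : (0 < #|S|)%N by rewrite cS.
rewrite (ext_gen_monomial iS); apply/Pc/Pg/IH.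
by move: cS; rewrite (cardsD1 i) iS => -[].
Qed.

Section CoefficientMap.
Variable sigma : {lrmorphism A -> A}.

Definition ext_map f : E := [ffun S : {set 'I_n} => sigma (f S)].

Fact ext_map_linear : linear ext_map.
Proof. by move=> c f g; apply/ffunP => S; rewrite !ffunE linearP. Qed.

Fact ext_map_monoid_morphism : GRing.monoid_morphism ext_map.
Proof.
split=> [|f g]; apply/ffunP => S; rewrite !ffunE ?rmorph_nat // rmorph_sum.
by apply: eq_bigr => T _; rewrite !ffunE !rmorphM rmorph_sign.
Qed.

HB.instance Definition _ := GRing.isLinear.Build k E E _ ext_map ext_map_linear.
HB.instance Definition _ :=
  GRing.isMonoidMorphism.Build E E ext_map ext_map_monoid_morphism.

Lemma ext_map_coef a : ext_map (coef a) = coef (sigma a).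
Proof. by apply/ffunP => S; rewrite !ffunE; case: ifP; rewrite ?rmorph0. Qed.

Lemma ext_map_gen i : ext_map (gen i) = gen i.
Proof. by apply/ffunP => S; rewrite !ffunE rmorph_nat. Qed.

End CoefficientMap.

(** The left partial derivative d/dw_i (interior product): it brings w_i to the front, with a sign
    counting the elements of [S] below [i], and then deletes it. *)
Definition contraction i f : E :=
  [ffun S : {set 'I_n} => if i \in S then 0 else (-1) ^+ ninv [set i] S * f (i |: S)].

Lemma contraction_linear i : linear (contraction i).
Proof.
move=> c f g; apply/ffunP => S; rewrite !ffunE.
by case: ifP => _; rewrite ?scaler0 ?addr0 // mulrDr scalerAr.
Qed.

HB.instance Definition _ i :=
  GRing.isLinear.Build k E E _ (contraction i) (contraction_linear i).

Lemma contraction_coef i a f : contraction i (coef a * f) = coef a * contraction i f.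
Proof.
rewrite !ext_coef_mull; apply/ffunP => S; rewrite !ffunE.
by case: ifP => _; rewrite ?mulr0 // mulrCA.
Qed.

Lemma contraction1 i : contraction i 1 = 0.
Proof.
apply/ffunP => S; rewrite !ffunE; case: ifP => // _.
by case: eqP => [/setP/(_ i)|]; rewrite ?mulr0 // !inE eqxx.
Qed.

(** The signed Leibniz rule: [contraction i] is an antiderivation. Together with the values on
    coefficients and on 1, it replaces the explicit signs from here on. *)
Lemma contraction_gen i j f :
  contraction i (gen j * f) = (i == j)%:R * f - gen j * contraction i f.
Proof.
apply/ffunP => S.
rewrite [LHS]ffunE ext_gen_mull !inE [RHS]ffunE [X in _ = _ + X]ffunE ext_gen_mull.
have [->|nij] := eqVneq i j; rewrite ?mul1r ?mul0r ?[(0 : E) _]ffunE ?eqxx /=.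
  case: ifP => jS.
    by rewrite ffunE !inE eqxx /= setD1K // mulrA -expr2 sqrr_sign mul1r subrr.
  by rewrite oppr0 addr0 setU1K ?jS // mulrA -expr2 sqrr_sign mul1r.
rewrite sub0r.
case: (boolP (j \in S)) => jS; last by rewrite mulr0 if_same oppr0.
rewrite ffunE !inE nij /=.
case: ifP => iS; first by rewrite mulr0 oppr0.
have e1 : ninv [set i] S = ((j < i) + ninv [set i] (S :\ j))%N.
  rewrite -{1}(setD1K jS) ninvUr; first by rewrite /ninv !big_set1.
  by rewrite disjoints1 !inE eqxx.
have eS : (i |: S) :\ j = i |: (S :\ j).
  by apply/setP => a; rewrite !inE; case: (eqVneq a i) => [->|//]; rewrite nij.
have e2 : ninv [set j] (i |: (S :\ j)) = ((i < j) + ninv [set j] (S :\ j))%N.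
  rewrite ninvUr; first by rewrite /ninv !big_set1.
  by rewrite disjoints1 !inE iS andbF.
(* For distinct [i] and [j] exactly one of the two comparisons holds; this is the origin of the
   minus sign in the rule. *)
have sgn : (-1) ^+ (j < i)%N * (-1) ^+ (i < j)%N = -1 :> A.
  by move: nij; case: (ltngtP i j) => [||/val_inj ->]; rewrite ?eqxx // ?mul1r ?mulr1.
rewrite eS e1 e2 !exprD mulrA mulrACA sgn mulN1r mulNr.
by rewrite -mulrA mulrCA.
Qed.

Section Transvection.
Variables (i i' : 'I_n) (p : A).

Definition transvection f : E := f + coef p * (gen i' * contraction i f).

Fact transvection_linear : linear transvection.
Proof.
move=> c f g; rewrite /transvection linearP mulrDr mulrDr -!scalerAr.
by rewrite addrACA scalerDr.
Qed.

HB.instance Definition _ := GRing.isLinear.Build k E E _ transvection transvection_linear.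

Lemma transvection_coef a f : transvection (coef a * f) = coef a * transvection f.
Proof.
rewrite /transvection contraction_coef mulrDr; congr (_ + _).
by rewrite [gen i' * _]mulrA -ext_coef_central !mulrA [coef p * _]ext_coef_central.
Qed.

Lemma transvection1 : transvection 1 = 1.
Proof. by rewrite /transvection contraction1 !mulr0 addr0. Qed.

Lemma transvection_gen j :
  transvection (gen j) = gen j + (i == j)%:R * coef p * gen i'.
Proof.
rewrite /transvection -{2}[gen j]mulr1 contraction_gen contraction1.
rewrite mulr0 subr0 mulr1; congr (_ + _).
by case: eqP => _; rewrite ?mulr1 ?mulr0 ?mul0r ?mul1r.
Qed.

(* [transvection] is [1 + D] for the derivation [D] = p w_i' d/dw_i; it is
   multiplicative because w_i' kills the image of [D]. *)
Lemma transvection_genM j f :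
  transvection (gen j * f) = transvection (gen j) * transvection f.
Proof.
rewrite transvection_gen /transvection contraction_gen.
pose D := coef p * (gen i' * contraction i f); rewrite -/D.
have wD0 : gen i' * D = 0.
  by rewrite mulrA -ext_coef_central -mulrA [gen i' * _]mulrA ext_gen_sq mul0r mulr0.
(* Moving [gen i'] past [gen j] yields a sign that cancels the one in [contraction_gen], so [D]
   obeys the unsigned Leibniz rule. *)
have jD : coef p * (gen i' * (gen j * contraction i f)) = - (gen j * D).
  rewrite [gen i' * _]mulrA ext_gen_anticomm mulNr mulrN -mulrA.
  by rewrite mulrA ext_coef_central -mulrA.
rewrite !mulrBr jD opprK mulrDl !mulrDr -[_ * gen i' * D]mulrA wD0 mulr0 addr0.
rewrite -addrA; congr (_ + _); rewrite addrC; congr (_ + _).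
by case: eqP => _; rewrite ?mulr1n ?mul1r ?mulr0n ?mul0r ?mulr0 ?mulrA.
Qed.

Fact transvectionM : {morph transvection : f g / f * g}.
Proof.
move=> f g; elim/ext_ind: f => [||f1 f2 IH1 IH2|a f IH|j f IH].
- by rewrite mul0r raddf0 mul0r.
- by rewrite transvection1 !mul1r.
- by rewrite mulrDl !raddfD /= IH1 IH2 [RHS]mulrDl.
- by rewrite -mulrA !transvection_coef IH mulrA.
- by rewrite -mulrA !transvection_genM IH mulrA.
Qed.

HB.instance Definition _ :=
  GRing.isMonoidMorphism.Build E E transvection (conj transvection1 transvectionM).

End Transvection.

End ExteriorMorphisms.

(** * Commutation and braid relations for transpositions *)

Lemma tperm_comm (T : finType) (a a' b b' c : T) :
    a != b -> a != b' -> a' != b -> a' != b' ->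
  tperm a a' (tperm b b' c) = tperm b b' (tperm a a' c).
Proof.
move=> nab nab' na'b na'b'; rewrite -!permM; congr (_ _ c).
by rewrite conjgC tpermJ !tpermD.
Qed.

(** Moving one transposition past another conjugates it into the transposition of the images; both
    sides then become the same product of three transpositions. *)
Lemma tperm_braid (T : finType) (a b c d : T) : a != b -> b != c -> a != c ->
  tperm a b (tperm b c (tperm a b d)) = tperm b c (tperm a b (tperm b c d)).
Proof.
move=> nab nbc nac.
suff /permP/(_ d) : (tperm a b * (tperm b c * tperm a b) =
                     tperm b c * (tperm a b * tperm b c))%g by rewrite !permM.
rewrite mulgA [(tperm a b * tperm b c)%g]conjgC tpermJ tpermL tpermD 1?eq_sym //.
rewrite -mulgA; congr (_ * _)%g.
by rewrite [RHS]conjgC tpermJ tpermR tpermD // 1?eq_sym // (tpermC b a).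
Qed.

(** * Actions of a group given by generators and relations, with involutive generators *)

Section PresentedAction.
Variables (I : choiceType) (rel : word I -> word I -> Prop) (T : Type).
Variable s : I -> T -> T.

(* Formal inverses act as the generators: the [s i] are meant to be involutions. *)
Definition word_act (u : word I) (x : T) : T := foldr (fun l => s l.1) x u.

(** This goes through a chosen representative word; that the choice is immaterial is
    [pres_act_class], which relies on the relations. *)
Definition pres_act (g : presgroup rel) : T -> T := word_act (repr g).

Lemma word_act_cat u v x : word_act (u ++ v) x = word_act u (word_act v x).
Proof. exact: foldr_cat. Qed.

Hypothesis sK : forall i, involutive (s i).

Lemma pres_act_unique (act : presgroup rel -> T -> T) :
  group_action act -> (forall i, act (pres_gen rel i) = s i) -> act = pres_act.
Proof.
move=> [act1 actM] actg.
have mulE u v : pres_class rel (u ++ v) = (pres_class rel u * pres_class rel v)%g.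
  exact/esym/pres_mulE.
have letter i b : act (pres_class rel [:: (i, b)]) =1 s i.
  case: b => [] x; last by rewrite -actg.
  (* A formal inverse must act as the inverse of [s i], which is [s i] itself: applying [s i] to
     both sides leaves the cancellation of a generator with its inverse. *)
  rewrite -[LHS](sK i); congr (s i _); rewrite -actg -actM -mulE.
  suff -> : pres_class rel (pword [:: i] ++ [:: (i, true)]) = 1%g by rewrite act1.
  by apply/pres_classP; exact: WCancel.
have actw u x : act (pres_class rel u) x = word_act u x.
  elim: u => [|[i b] u IH]; first exact: act1.
  by rewrite -cat1s mulE actM IH letter.
by apply/funext => g; apply/funext => x; rewrite -{1}[g]pres_reprK actw.
Qed.

Hypothesis s_rel : forall u v, rel u v -> word_act u =1 word_act v.

Lemma word_act_wcong u v : wcong rel u v -> word_act u =1 word_act v.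
Proof.
elim=> {u v} [u|u v _ IH|u v w _ IHu _ IHv|u u' v v' _ IHu _ IHv|i b|u v /s_rel //] x //.
- by rewrite IHu IHv.
- by rewrite !word_act_cat IHv IHu.
- exact: sK.
Qed.

Lemma pres_act_class u : pres_act (pres_class rel u) =1 word_act u.
Proof. exact/word_act_wcong/wcong_repr. Qed.

Lemma pres_act_action : group_action pres_act.
Proof.
split=> [x|g h x]; first exact: (pres_act_class [::]).
by rewrite [LHS]pres_act_class word_act_cat.
Qed.

Lemma pres_act_gen i : pres_act (pres_gen rel i) = s i.
Proof. by apply/funext => x; rewrite pres_act_class. Qed.

End PresentedAction.

(** Compares the two sides of the braid relation on the middle generator [pw j]. *)
Lemma addr_mul_telescope (R : pzRingType) (a b c u v : R) :
  u + (b - c) * v + (a - b) * v = u + (a - c) * v.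
Proof. by rewrite addrAC -addrA -mulrDl subrKA. Qed.

(** Compares the two sides of the braid relation on [pw i]: [a], [b], [c] stand for the squares of
    three consecutive [px], and [u], [v], [w] for the corresponding [pw]. The coefficients of [v]
    telescope, and those of [w] agree up to commutation. *)
Lemma braid_identity (R : pzRingType) (a b c u v w : R) :
    a * b = b * a -> a * c = c * a -> b * c = c * b ->
  u + (a - b) * v + (b - c) * (v + (a - c) * w) = u + (a - c) * (v + (b - c) * w).
Proof.
move=> ab ac bc; rewrite 2![_ * (v + _)]mulrDr addrA -[X in X + _]addrA -mulrDl subrKA.
suff cc : GRing.comm (b - c) (a - c) by rewrite -addrA [in LHS]mulrA cc -mulrA.
by apply: commrB; apply/commr_sym/commrB.
Qed.

(** * The simple reflections on polynomials tensored with the exterior algebra *)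

Section PolynomialExterior.
Variable n : nat.
Local Notation E := (Pext n).
Implicit Types i j l : 'I_n.

(** Agreement on the [px] extends to all coefficients by expanding a polynomial into monomials;
    [ext_ind] then brings in the [pw]. *)
Lemma Pext_lrmorphism_eq (f g : {lrmorphism E -> E}) :
    (forall i, f (px i) = g (px i)) -> (forall i, f (pw i) = g (pw i)) ->
  f =1 g.
Proof.
move=> fgx fgw.
have fgc a : f (ext_coef n a) = g (ext_coef n a).
  rewrite [a]mpolyE !rmorph_sum /=; apply: eq_bigr => m _.
  rewrite !linearZ /=; congr (_ *: _).
  rewrite mpolyXE_id !rmorph_prod; apply: eq_bigr => i _ /=.
  by rewrite !rmorphXn /= [f _]fgx.
elim/ext_ind => [||h1 h2 IH1 IH2|a h IH|i h IH].
- by rewrite !rmorph0.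
- by rewrite !rmorph1.
- by rewrite !rmorphD /= [f h1]IH1 [f h2]IH2.
- by rewrite !rmorphM /= fgc [f h]IH.
- by rewrite !rmorphM /= [f (ext_gen _ _)]fgw [f h]IH.
Qed.

(** The underlying function is [f] by conversion, so facts about [f] and about the packed morphism
    can be interchanged. *)
Definition lrmorphism_of (f : E -> E) (fP : algebra_automorphism f) :
    {lrmorphism E -> E} :=
  HB.pack f
    (GRing.isLinear.Build rat E E _ f (let: And3 lin _ _ := fP in lin))
    (GRing.isMonoidMorphism.Build E E f (let: And3 _ mon _ := fP in mon)).

(** [insub i.+1] separates the two kinds of reflections: it is [None] exactly when [i] is the last
    index. *)
Definition reflection_coef (i : 'I_n) : n.-tuple {mpoly rat[n]} :=
  [tuple (if insub i.+1 is Some i' then 'X_(tperm i i' j)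
          else if j == i then - 'X_j else 'X_j) | j < n].

Definition reflection (i : 'I_n) (f : E) : E :=
  let g := ext_map (comp_mpoly (reflection_coef i)) f in
  if insub i.+1 is Some i' then transvection i i' ('X_i ^+ 2 - 'X_i' ^+ 2) g else g.

Fact reflection_linear i : linear (reflection i).
Proof. by rewrite /reflection; case: insub => [i'|] c f g /=; rewrite !linearP. Qed.

Fact reflection_monoid_morphism i : GRing.monoid_morphism (reflection i).
Proof.
by rewrite /reflection; case: insub => [i'|]; split=> [|f g]; rewrite ?rmorph1 ?rmorphM.
Qed.

HB.instance Definition _ i :=
  GRing.isLinear.Build rat E E _ (reflection i) (reflection_linear i).
HB.instance Definition _ i :=
  GRing.isMonoidMorphism.Build E E (reflection i) (reflection_monoid_morphism i).

Lemma reflectionP i : simple_reflection_on_generators i (reflection i).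
Proof.
split=> [i' ii' j|lin j]; rewrite /reflection.
  have e : insub i.+1 = Some i' by rewrite ii' valK.
  rewrite e /px /pw ext_map_coef ext_map_gen /= comp_mpolyXU -tnth_nth tnth_mktuple e.
  split; last by rewrite transvection_gen rmorphB !rmorphXn.
  by rewrite -[ext_coef _ _]mulr1 transvection_coef transvection1.
have e : insub i.+1 = None :> option 'I_n by rewrite insubF // lin ltnn.
rewrite e /px /pw ext_map_coef ext_map_gen /= comp_mpolyXU -tnth_nth tnth_mktuple e.
by split=> //; case: ifP => // _; rewrite raddfN.
Qed.

Lemma ord_succ_or_last (i : 'I_n) : {i' : 'I_n | i.+1 = i'} + {i.+1 = n}.
Proof.
have [lt_in|le_ni] := ltnP i.+1 n; first by left; exists (Ordinal lt_in).
by right; apply/eqP; rewrite eqn_leq le_ni ltn_ord.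
Qed.

Lemma simple_reflection_unique i (f g : {lrmorphism E -> E}) :
  simple_reflection_on_generators i f -> simple_reflection_on_generators i g -> f =1 g.
Proof.
move=> [f1 f2] [g1 g2]; apply: Pext_lrmorphism_eq => j;
  (case: (ord_succ_or_last i) => [[i' ii']|lin];
   [have [fx fw] := f1 _ ii' j; have [gx gw] := g1 _ ii' j
   |have [fx fw] := f2 lin j; have [gx gw] := g2 lin j]).
- by rewrite fx gx.
- by rewrite fx gx.
- by rewrite fw gw.
- by rewrite fw gw.
Qed.

(** * The Weyl group relations, for any family of morphisms with the prescribed values; this covers
    both the constructed reflections and an arbitrary given family *)

Section Relations.
Variable s : 'I_n -> {lrmorphism E -> E}.
Hypothesis sP : forall i, simple_reflection_on_generators i (s i).

Lemma refl_px i i' j : i.+1 = i' -> s i (px j) = px (tperm i i' j).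
Proof. by move=> ii'; have [/(_ _ ii' j)[-> _] _] := sP i. Qed.

Lemma refl_pw i i' : i.+1 = i' ->
  s i (pw i) = pw i + (px i ^+ 2 - px i' ^+ 2) * pw i'.
Proof. by move=> ii'; have [/(_ _ ii' i)[_ ->] _] := sP i; rewrite eqxx mul1r. Qed.

Lemma refl_pw_neq i j : i != j -> s i (pw j) = pw j.
Proof.
move=> nij; case: (ord_succ_or_last i) => [[i' ii']|lin].
  by have [/(_ _ ii' j)[_ ->] _] := sP i; rewrite (negPf nij) !mul0r addr0.
by have [_ /(_ lin j)[_ ->]] := sP i.
Qed.

Lemma refl_last_px l : l.+1 = n -> s l (px l) = - px l.
Proof. by move=> ln; have [_ /(_ ln l)[-> _]] := sP l; rewrite eqxx. Qed.

Lemma refl_last_px_neq l j : l.+1 = n -> j != l -> s l (px j) = px j.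
Proof. by move=> ln /negPf nlj; have [_ /(_ ln j)[-> _]] := sP l; rewrite nlj. Qed.

Lemma refl_last_pw l j : l.+1 = n -> s l (pw j) = pw j.
Proof. by move=> ln; have [_ /(_ ln j)[_ ->]] := sP l. Qed.

Lemma refl_involutive i : involutive (s i).
Proof.
apply: (Pext_lrmorphism_eq (f := s i \o s i) (g := idfun)) => j /=.
  case: (ord_succ_or_last i) => [[i' ii']|lin].
    by rewrite !(refl_px _ ii') tpermK.
  have [->|nji] := eqVneq j i; last by rewrite !refl_last_px_neq.
  by rewrite refl_last_px // rmorphN /= refl_last_px ?opprK.
case: (ord_succ_or_last i) => [[i' ii']|lin]; last by rewrite !refl_last_pw.
have [<-|nij] := eqVneq i j; last by rewrite !refl_pw_neq.
have nii' : i != i' by rewrite -val_eqE /= -ii' neq_ltn ltnSn.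
(* Swapping the two variables negates the difference of squares, so the second correction term
   cancels the first. *)
rewrite (refl_pw ii') rmorphD rmorphM rmorphB !rmorphXn /= !(refl_px _ ii') (refl_pw ii').
by rewrite tpermL tpermR (refl_pw_neq nii') -addrA -mulrDl subrKA subrr mul0r addr0.
Qed.

(** The pairs of indices involved are disjoint, so each reflection fixes the correction term of the
    other. *)
Lemma refl_comm i j f : (i.+1 < j)%N -> (j.+1 < n)%N -> s i (s j f) = s j (s i f).
Proof.
move=> lt_ij lt_jn.
have lt_in : (i.+1 < n)%N by apply: ltn_trans (ltn_ord j).
have ii' : i.+1 = Ordinal lt_in by [].
have jj' : j.+1 = Ordinal lt_jn by [].
move: (Ordinal lt_in) (Ordinal lt_jn) ii' jj' => i' j' ii' jj'.
have nij : i != j by rewrite -val_eqE /=; lia.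
have nij' : i != j' by rewrite -val_eqE /=; lia.
have ni'j : i' != j by rewrite -val_eqE /=; lia.
have ni'j' : i' != j' by rewrite -val_eqE /=; lia.
apply: (Pext_lrmorphism_eq (f := s i \o s j) (g := s j \o s i)) => a /=.
  by rewrite !(refl_px _ ii') !(refl_px _ jj') !(refl_px _ ii') tperm_comm.
have [<-|nia] := eqVneq i a.
  rewrite (refl_pw_neq (i := j)) 1?eq_sym // (refl_pw ii').
  rewrite rmorphD rmorphM rmorphB !rmorphXn /= !(refl_px _ jj').
  by rewrite !tpermD 1?eq_sym // !refl_pw_neq 1?eq_sym.
rewrite (refl_pw_neq nia).
have [<-|nja] := eqVneq j a; last by rewrite !refl_pw_neq.
rewrite (refl_pw jj') rmorphD rmorphM rmorphB !rmorphXn /= !(refl_px _ ii').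
by rewrite !tpermD // !refl_pw_neq.
Qed.

(** On the [px] this is the braid relation for transpositions. Among the [pw] only [pw i] and [pw j]
    are moved, and they are settled by [braid_identity] and [addr_mul_telescope]. *)
Lemma refl_braid i j f : i.+1 = j -> (j.+1 < n)%N ->
  s i (s j (s i f)) = s j (s i (s j f)).
Proof.
move=> ij lt_jn.
have jk : j.+1 = Ordinal lt_jn by [].
move: (Ordinal lt_jn) jk => k jk.
have nij : i != j by rewrite -val_eqE /=; lia.
have njk : j != k by rewrite -val_eqE /=; lia.
have nik : i != k by rewrite -val_eqE /=; lia.
have nji : j != i by rewrite eq_sym.
have nki : k != i by rewrite eq_sym.
apply: (Pext_lrmorphism_eq (f := s i \o s j \o s i) (g := s j \o s i \o s j)) => a /=.
  rewrite !(refl_px _ ij, refl_px _ jk); congr (px _).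
  exact: tperm_braid.
(* [y] is kept abstract so that [rmorphM] does not expand the squares. *)
have [y [yi yj wi wj yC]] : exists y : 'I_n -> E,
    [/\ forall b, s i (y b) = y (tperm i j b),
        forall b, s j (y b) = y (tperm j k b),
        s i (pw i) = pw i + (y i - y j) * pw j,
        s j (pw j) = pw j + (y j - y k) * pw k
      & forall b h, y b * h = h * y b].
  exists (fun b => px b ^+ 2); split=> [b|b|||b h].
  - by rewrite rmorphXn /= (refl_px _ ij).
  - by rewrite rmorphXn /= (refl_px _ jk).
  - exact: refl_pw.
  - exact: refl_pw.
  - by rewrite -[px b ^+ 2]rmorphXn; exact: ext_coef_central.
have [<-|nia] := eqVneq i a.
  rewrite (refl_pw_neq nji) !wi !rmorphD !rmorphM !rmorphB /= !yj.
  rewrite wj (refl_pw_neq nji) tpermL (tpermD nji nki).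
  rewrite !rmorphD !rmorphM !rmorphB /= !yi wi !(refl_pw_neq nij) (refl_pw_neq nik).
  rewrite tpermL tpermR (tpermD nik njk).
  by apply: braid_identity; exact: yC.
have [<-|nja] := eqVneq j a; last by rewrite !refl_pw_neq.
rewrite (refl_pw_neq nij) !wj !rmorphD !rmorphM !rmorphB /= !yi.
rewrite (refl_pw_neq nij) (refl_pw_neq nik) tpermR (tpermD nik njk).
rewrite !yj wj (refl_pw_neq njk) tpermR (tpermD nji nki).
exact/esym/addr_mul_telescope.
Qed.

Lemma refl_last_comm i l f : l.+1 = n -> (i.+1 < l)%N -> s l (s i f) = s i (s l f).
Proof.
move=> ln lt_il.
have lt_in : (i.+1 < n)%N by apply: ltn_trans (ltn_ord l).
have ii' : i.+1 = Ordinal lt_in by [].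
move: (Ordinal lt_in) ii' => i' ii'.
have nil : i != l by rewrite -val_eqE /=; lia.
have ni'l : i' != l by rewrite -val_eqE /=; lia.
apply: (Pext_lrmorphism_eq (f := s l \o s i) (g := s i \o s l)) => a /=.
  rewrite (refl_px _ ii'); have [->|nal] := eqVneq a l.
    by rewrite tpermD // refl_last_px // rmorphN /= (refl_px _ ii') tpermD.
  rewrite (refl_last_px_neq ln nal) (refl_px _ ii') refl_last_px_neq //.
  (* The transposition fixes [l], so by injectivity it sends no other index to [l]. *)
  by rewrite -(tpermD nil ni'l) (inj_eq perm_inj).
rewrite (refl_last_pw _ ln).
have [<-|nia] := eqVneq i a; last by rewrite refl_pw_neq // refl_last_pw.
rewrite (refl_pw ii') rmorphD rmorphM rmorphB !rmorphXn /= !(refl_last_pw _ ln).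
by rewrite !refl_last_px_neq.
Qed.

Lemma refl_last_braid i l f : l.+1 = n -> i.+1 = l ->
  s l (s i (s l (s i f))) = s i (s l (s i (s l f))).
Proof.
move=> ln il.
have nil : i != l by rewrite -val_eqE /=; lia.
apply: (Pext_lrmorphism_eq (f := s l \o s i \o s l \o s i)
                           (g := s i \o s l \o s i \o s l)) => a /=.
  have si_i : s i (px i) = px l by rewrite (refl_px _ il) tpermL.
  have si_l : s i (px l) = px i by rewrite (refl_px _ il) tpermR.
  have sl_i : s l (px i) = px i by rewrite refl_last_px_neq.
  have sl_l : s l (px l) = - px l by rewrite refl_last_px.
  have sN b h : s b (- h) = - s b h by rewrite rmorphN.
  have [->|nai] := eqVneq a i; first by rewrite !(si_i, si_l, sl_i, sl_l, sN).
  have [->|nal] := eqVneq a l; first by rewrite !(si_i, si_l, sl_i, sl_l, sN).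
  have si_a : s i (px a) = px a by rewrite (refl_px _ il) tpermD // eq_sym.
  have sl_a : s l (px a) = px a by rewrite refl_last_px_neq.
  by rewrite !(si_a, sl_a).
(* [s l] only negates [px l], which enters [s i (pw a)] through its square. Hence both sides of the
   relation collapse to [pw a] by involutivity of [s i]. *)
have slw : s l (s i (pw a)) = s i (pw a).
  have [<-|nia] := eqVneq i a; last by rewrite refl_pw_neq // refl_last_pw.
  rewrite (refl_pw il) rmorphD rmorphM rmorphB !rmorphXn /= !(refl_last_pw _ ln).
  by rewrite (refl_last_px_neq ln nil) (refl_last_px ln) sqrrN.
by rewrite (refl_last_pw _ ln) !slw !refl_involutive (refl_last_pw _ ln).
Qed.

Lemma word_act_weylB_rel u v :
  weylB_rel u v -> word_act (fun i => s i) u =1 word_act (fun i => s i) v.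
Proof.
case=> [i _|i j lt_ij lt_jn|i j ij lt_jn|l _|i l ln lt_il|i l ln il] f /=.
- exact: refl_involutive.
- exact: refl_comm.
- exact: refl_braid.
- exact: refl_involutive.
- exact: refl_last_comm.
- exact: refl_last_braid.
Qed.

End Relations.

Lemma reflection_automorphism i : algebra_automorphism (reflection i).
Proof.
split; [exact: reflection_linear | exact: reflection_monoid_morphism |].
exact: inv_bij (refl_involutive reflectionP i).
Qed.

Lemma word_act_automorphism (s : 'I_n -> E -> E) u :
  (forall i, algebra_automorphism (s i)) -> algebra_automorphism (word_act s u).
Proof.
move=> sA; elim: u => [|[i b] u [lu [u1 uM] bu]].
  by split=> //; exists id.
have [ls [s1 sM] bs] := sA i; split=> [c f g|| /=].
- by rewrite /= lu ls.
- by split=> [|f g] /=; rewrite ?u1 ?s1 // uM sM.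
- exact: bij_comp.
Qed.

End PolynomialExterior.

(** * Existence and uniqueness of the reflections and of the resulting action *)

Theorem lemma1 (n : nat) (hn : (1 <= n)%N) :
  (forall i : 'I_n, exists! f : Pext n -> Pext n,
     algebra_automorphism f /\ simple_reflection_on_generators i f) /\
  (forall s : 'I_n -> Pext n -> Pext n,
     (forall i : 'I_n,
        algebra_automorphism (s i) /\ simple_reflection_on_generators i (s i)) ->
     exists! act : weylB n -> Pext n -> Pext n,
       [/\ group_action act,
           forall g : weylB n, algebra_automorphism (act g) &
           forall i : 'I_n, act (weylB_gen i) = s i]).
Proof.
split=> [i|s sP].
  exists (reflection i); split=> [|f [fA fP]].
    by split; [exact: reflection_automorphism | exact: reflectionP].
  apply/funext/(simple_reflection_unique (i := i) (g := lrmorphism_of fA)) => //.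
  exact: reflectionP.
(* The given automorphisms are packed as morphisms so that the relations proved above apply to
   them. *)
pose sL i := lrmorphism_of (proj1 (sP i)).
have sLP i : simple_reflection_on_generators i (sL i) := proj2 (sP i).
have sK i : involutive (s i) := refl_involutive sLP i.
have sR u v : weylB_rel u v -> word_act s u =1 word_act s v.
  exact: (word_act_weylB_rel sLP).
exists (pres_act (rel := @weylB_rel n) s); split=> [|act [actA _ actg]].
  split=> [|g|i]; first exact: pres_act_action.
    by apply: word_act_automorphism => i; exact: (proj1 (sP i)).
  exact: pres_act_gen.
exact/esym/pres_act_unique.
Qed.
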